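(* Let $G$ be a finite simple cubic graph that contains no cycle of length $4$. Then $\frac{i(G)}{\gamma(G)} \le \frac{5}{4}$.
   Context: A dominating set of $G$ is a set $S\subseteq V(G)$ such that every vertex not in $S$ has a neighbor in $S$. The domination number $\gamma(G)$ is the minimum size of a dominating set of $G$, and the independent domination number $i(G)$ is the minimum size of a dominating set of $G$ that is also an independent set. A graph is cubic if every vertex has degree $3$; ''contains no cycle of length $4$'' means no $4$-cycle as a subgraph. *)

(* Defs.v *)
From mathcomp Require Import all_boot all_order all_algebra.

Set Implicit Arguments.
Unset Strict Implicit.
Unset Printing Implicit Defensive.

(* A finite simple graph is a finType of vertices with a symmetric,
   irreflexive adjacency relation. *)
Definition simple_graph (V : finType) (adj : rel V) : Prop :=
  symmetric adj /\ irreflexive adj.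

Definition degree (V : finType) (adj : rel V) (x : V) : nat :=
  #|[set y | adj x y]|.

Definition cubic (V : finType) (adj : rel V) : Prop :=
  forall x : V, degree adj x = 3.

(* The cycle need not be induced: chords are allowed. *)
Definition has_C4 (V : finType) (adj : rel V) : Prop :=
  exists2 c : seq V, size c = 4 & ucycle adj c.

Definition dominating (V : finType) (adj : rel V) (S : {set V}) : bool :=
  [forall x, (x \notin S) ==> [exists y in S, adj x y]].

Definition independent (V : finType) (adj : rel V) (S : {set V}) : bool :=
  [forall x in S, forall y in S, ~~ adj x y].

(* In the two minima below, the default value #|V| bounds the size of every
   vertex set and both families are nonempty for a simple graph (the second
   contains every maximal independent set), so these are genuine minima. *)
Definition domination_number (V : finType) (adj : rel V) : nat :=
  \big[minn/#|V|]_(S : {set V} | dominating adj S) #|S|.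

Definition independent_domination_number (V : finType) (adj : rel V) : nat :=
  \big[minn/#|V|]_(S : {set V} | dominating adj S && independent adj S) #|S|.

(* Main.v *)
Require Import Defs.
From mathcomp Require Import all_boot all_order all_algebra.
From mathcomp Require Import zify.

(** Let S be a minimum dominating set with as few edges inside as possible.
    Exchanging a vertex for a private neighbour shows that G[S] consists of m
    isolated vertices (the set I) and k single edges, and that both outer
    neighbours of an endpoint of such an edge are private and nonadjacent.

    Drop one endpoint of each edge.  The dropped endpoints form T, the kept ones
    B, and U is the set of the 2k vertices left undominated.  Choose T so that
    G[U] has as many edges as possible: flipping one edge cannot help, so, with
    W the set of vertices outside S all of whose neighbours in S lie in I,
    counting the ends leaving U gives e(U,W) >= 4k - 2e(U,U), where e counts
    ordered pairs.

    Now I and B extend greedily to an independent dominating set of size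
    m + 3k, which is to be improved by k/2 - m/4.  The non-isolated part U1 of
    G[U] has maximum degree 2 and can be dominated by |U1|/2 of its vertices.
    As for the isolated part U0, removing a vertex s of I allows its private
    neighbours to be taken instead, and these save the vertices of U0 that they
    cover.  Such replacements at s and s' interfere only if s' is reached through
    one of the six edges leaving N(s) other than those to s, so a greedy choice of
    pairwise compatible replacements achieves one seventh of the total gain,
    where one eighth suffices. *)

(** * Greedy choice of a weighted independent set *)

Section Greedy.
Set Implicit Arguments.
Unset Strict Implicit.

(** A heaviest vertex [x] is kept and deleted together with its at most [d] neighbours, each of
    weight at most [g x]; induction treats the rest. *)
Lemma weighted_independent_set (T : finType) (r : rel T) (g : T -> nat) d
    (X : {set T}) :
    symmetric r -> irreflexive r ->
    {in X, forall x, #|[set y in X | r x y]| <= d} ->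
  exists R : {set T}, [/\ R \subset X, {in R &, forall x y, ~~ r x y}
    & \sum_(x in X) g x <= d.+1 * \sum_(x in R) g x].
Proof.
move=> rsym rirr; have [n] := ubnP #|X|; elim: n X => // n IHn X ltXn degX.
have [->|[x0 Xx0]] := set_0Vmem X.
  by exists set0; split; rewrite ?sub0set ?big_set0 // => x; rewrite inE.
have [x Xx gmax] : exists2 x, x \in X & {in X, forall y, g y <= g x}.
  by case: (arg_maxnP g Xx0) => x; exists x.
pose N := x |: [set y in X | r x y].
have sNX : N \subset X.
  by apply/subsetP => y; rewrite !inE => /predU1P[->|/andP[]].
have Nx : x \in N by rewrite setU11.
have [||R [sRX indR sumR]] := IHn (X :\: N).
- rewrite -ltnS; apply: leq_trans ltXn; rewrite ltnS; apply: proper_card.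
  by rewrite properE subsetDl; apply/subsetPn; exists x; rewrite ?inE ?eqxx.
- move=> y; rewrite inE => /andP[_ Xy]; apply: leq_trans (degX y Xy).
  apply: subset_leq_card; apply/subsetP => z; rewrite !inE => /andP[/andP[_ ->]].
  by [].
have NRx : x \notin R.
  by apply: contraL Nx => /(subsetP sRX); rewrite inE => /andP[].
have xR y : y \in R -> ~~ r x y.
  move/(subsetP sRX); rewrite !inE => /andP[+ Xy].
  by rewrite negb_or Xy => /andP[_].
exists (x |: R); split.
- by rewrite subUset sub1set Xx (subset_trans sRX) ?subsetDl.
- move=> y z; rewrite !inE => /predU1P[->|Ry] /predU1P[->|Rz].
  + by rewrite rirr.
  + exact: xR.
  + by rewrite rsym xR.
  + exact: indR.
rewrite big_setU1 //= mulnDr (big_setID N) /=.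
rewrite (setIidPr sNX) leq_add //.
apply: leq_trans (_ : \sum_(y in N) g x <= _).
  by apply: leq_sum => y /(subsetP sNX) /gmax.
rewrite sum_nat_const leq_mul2r; apply/orP; right.
by rewrite cardsU1 (leq_trans (leq_add (leq_b1 _) (degX x Xx))).
Qed.

Lemma card_bigcup_le (I T : finType) (A : {set I}) (F : I -> {set T}) :
  #|\bigcup_(i in A) F i| <= \sum_(i in A) #|F i|.
Proof.
elim/big_rec2: _ => [|i m B _ leBm]; first by rewrite cards0.
by rewrite (leq_trans (leq_card_setU _ _)) ?leq_add2l.
Qed.

End Greedy.

(** * Edge counts, independence and domination *)

Section Graph.
Set Implicit Arguments.
Unset Strict Implicit.

Variables (V : finType) (adj : rel V).
Hypotheses (adjC : symmetric adj) (adjN : irreflexive adj).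

Definition nbhd x := [set y | adj x y].
Local Notation N := nbhd.

Definition edges (A B : {set V}) := \sum_(x in A) #|N x :&: B|.

Lemma in_nbhd x y : (y \in N x) = adj x y. Proof. by rewrite inE. Qed.

Lemma in_nbhdC x y : (y \in N x) = (x \in N y). Proof. by rewrite !inE adjC. Qed.

(** Double counting of the adjacent pairs between [A] and [B], each weighted by its end in [B]. *)
Lemma sum_nbhd (A B : {set V}) (f : V -> nat) :
  \sum_(x in A) \sum_(y in N x :&: B) f y = \sum_(y in B) #|N y :&: A| * f y.
Proof.
rewrite (exchange_big_dep (mem B)) => [|x y _ /setIP[]//] /=.
apply: eq_bigr => y By; rewrite -sum_nat_const; apply: eq_bigl => x.
by rewrite !inE By andbT adjC andbC.
Qed.

Lemma edgesC A B : edges A B = edges B A.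
Proof.
rewrite /edges; under eq_bigr do rewrite -sum1_card.
by rewrite sum_nbhd; under eq_bigr do rewrite muln1.
Qed.

Lemma edgesUl (A B C : {set V}) : [disjoint A & B] ->
  edges (A :|: B) C = edges A C + edges B C.
Proof. by move=> dAB; rewrite /edges; under eq_bigl do rewrite inE; rewrite bigU. Qed.

Lemma edgesUr (A B C : {set V}) : [disjoint A & B] ->
  edges C (A :|: B) = edges C A + edges C B.
Proof. by move=> dAB; rewrite !(edgesC C) edgesUl. Qed.

Lemma edges_eq0 (A B : {set V}) : {in A & B, forall x y, ~~ adj x y} -> edges A B = 0.
Proof.
move=> nAB; apply: big1 => x Ax; apply/eqP; rewrite cards_eq0 -subset0.
by apply/subsetP => y /setIP[]; rewrite !inE => xy /(nAB x y Ax); rewrite xy.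
Qed.

Lemma edges_sqU (A B : {set V}) : [disjoint A & B] ->
  edges (A :|: B) (A :|: B) = edges A A + 2 * edges A B + edges B B.
Proof.
by move=> dAB; rewrite edgesUl // !edgesUr // (edgesC B A) mul2n -addnn !addnA.
Qed.

Lemma edges1 x A : edges [set x] A = #|N x :&: A|.
Proof. by rewrite /edges big_set1. Qed.

Lemma indepP (A : {set V}) :
  reflect {in A &, forall x y, ~~ adj x y} (independent adj A).
Proof.
apply: (iffP forall_inP) => [h x y Ax Ay|h x Ax]; first exact: (forall_inP (h x Ax)).
by apply/forall_inP => y; exact: h.
Qed.

Lemma domP (A : {set V}) :
  reflect (forall x, x \notin A -> exists2 y, y \in A & adj x y) (dominating adj A).
Proof.
apply: (iffP forallP) => h x; first by move=> Ax; apply/exists_inP/(implyP (h x)).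
by apply/implyP => Ax; apply/exists_inP/h.
Qed.

(** A largest independent set between [C] and [X] works. Choosing [X] smaller than the whole vertex
    set holds some vertices back until the others have had their chance. *)
Lemma maximal_independent (C X : {set V}) :
    independent adj C -> C \subset X ->
  exists M : {set V}, [/\ C \subset M, M \subset X, independent adj M &
    forall x, x \in X -> x \notin M -> exists2 y, y \in M & adj x y].
Proof.
move=> iC sCX.
pose P := [pred M : {set V} | [&& C \subset M, M \subset X & independent adj M]].
have PC : P C by rewrite /= subxx sCX.
case: (arg_maxnP (fun M : {set V} => #|M|) PC) => M /and3P[sCM sMX iM] maxM.
exists M; split=> // x Xx NMx; apply/exists_inP; apply: contraNT NMx => /exists_inPn xM.
have /maxM : P (x |: M).
  rewrite /= (subset_trans sCM) ?subsetUr //= subUset sub1set Xx sMX /=.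
  apply/indepP => y z; rewrite !inE => /predU1P[->|My] /predU1P[->|Mz].
  - by rewrite adjN.
  - exact: xM.
  - by rewrite adjC xM.
  - exact: (indepP _ iM).
by rewrite /= cardsU1; case: (x \in M) => //=; rewrite add1n ltnn.
Qed.

Lemma independentU (A B : {set V}) :
    independent adj A -> independent adj B -> {in A & B, forall x y, ~~ adj x y} ->
  independent adj (A :|: B).
Proof.
move=> /indepP iA /indepP iB nAB; apply/indepP => x y.
rewrite !inE => /orP[Ax|Bx] /orP[Ay|By]; [exact: iA|exact: nAB| |exact: iB].
by rewrite adjC nAB.
Qed.

Lemma independentS (A B : {set V}) :
  A \subset B -> independent adj B -> independent adj A.
Proof.
by move=> /subsetP sAB /indepP iB; apply/indepP => x y /sAB Bx /sAB; exact: iB.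
Qed.

(** * Consequences of the absence of 4-cycles *)

Hypothesis noC4 : ~ has_C4 adj.

Lemma common_nbhd a b c d :
  a != c -> adj a b -> adj c b -> adj a d -> adj c d -> b = d.
Proof.
move=> ac ab cb ad cd; apply/eqP; apply: contra_notT noC4 => bd.
exists [:: a; b; c; d] => //; rewrite /ucycle /= ab (adjC b) cb cd (adjC d) ad /=.
have ne x y : adj x y -> x != y by apply: contraL => /eqP ->; rewrite adjN.
by rewrite !inE !negb_or ac bd !ne // adjC.
Qed.

(* The boundary of [N[v]] meets each outside vertex at most once because there
   is no 4-cycle; so deleting [N[v]] isolates few vertices when [v] is the
   neighbour of a leaf, or when there are no leaves. *)
Lemma indep_dom_degree_le2 (X : {set V}) :
    {in X, forall x, #|N x :&: X| <= 2} ->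
  exists D : {set V}, [/\ D \subset X, independent adj D,
    forall x, x \in X -> x \notin D -> exists2 y, y \in D & adj x y
    & 2 * #|D| <= #|X| + #|[set x in X | N x :&: X == set0]|].
Proof.
have [n] := ubnP #|X|; elim: n X => // n IHn X ltXn degX.
have [->|[x0 Xx0]] := set_0Vmem X.
  exists set0; split; rewrite ?sub0set ?cards0 //.
  - by apply/indepP => x y; rewrite inE.
  - by move=> x; rewrite inE.
pose iso (Y : {set V}) := [set x in Y | N x :&: Y == set0].
(* [#|X| + #|iso X|] serves as a potential: choosing [v] costs 2, which the deletion of its closed
   neighbourhood has to release. *)
suff [v Xv dropv] : exists2 v, v \in X &
    2 + #|iso (X :\: (v |: N v))| <= #|(v |: N v) :&: X| + #|iso X|.
  have [||D [sDX iD domD cardD]] := IHn (X :\: (v |: N v)).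
  - rewrite -ltnS; apply: leq_trans ltXn; rewrite ltnS; apply: proper_card.
    by rewrite properE subsetDl; apply/subsetPn; exists v; rewrite ?inE ?eqxx.
  - move=> x; rewrite inE => /andP[_ Xx]; apply: leq_trans (degX x Xx).
    by rewrite subset_leq_card // setIS // subsetDl.
  have vD x : x \in D -> ~~ adj v x.
    by move/(subsetP sDX); rewrite !inE => /andP[/norP[]].
  have NDv : v \notin D.
    by apply/negP => /(subsetP sDX); rewrite !inE eqxx.
  exists (v |: D); split.
  - by rewrite subUset sub1set Xv (subset_trans sDX) ?subsetDl.
  - apply/indepP => y z; rewrite !inE => /predU1P[->|My] /predU1P[->|Mz].
    + by rewrite adjN.
    + exact: vD.
    + by rewrite adjC vD.
    + exact: (indepP _ iD).
  - move=> x Xx; rewrite !inE => /norP[xv Dx].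
    have [vx|nvx] := boolP (adj v x).
      by exists v; rewrite ?inE ?eqxx // adjC.
    have [|y Dy xy] := domD x _ Dx; first by rewrite !inE negb_or xv nvx.
    by exists y; rewrite // inE Dy orbT.
  - rewrite cardsU1 NDv mulnDr.
    have := cardsID (v |: N v) X; rewrite setIC.
    move: cardD dropv; rewrite /iso; lia.

have cardNX v : v \in X -> #|(v |: N v) :&: X| = #|N v :&: X|.+1.
  move=> Xv; rewrite setIUl (setIidPl _) ?sub1set // cardsU1.
  by rewrite !inE adjN.
have isoX' v x : v \in X -> N x :&: X != set0 -> x \in iso (X :\: (v |: N v)) ->
    exists2 z, z \in N v :&: X & (x \in (N z :&: X) :\ v).
  move=> Xv /set0Pn[z /setIP[xz Xz]]; rewrite !inE negb_or -andbA.
  case/andP=> /andP[xv nvx] /andP[Xx /eqP isox].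
  move: xz; rewrite inE => xz; exists z; last by rewrite !inE xv Xx adjC xz.
  rewrite !inE Xz andbT; apply: contraT => nvz.
  have /setP/(_ z) := isox; rewrite !inE xz Xz (negbTE nvz) orbF andbT.
  by case: eqP => // zv; move: nvx; rewrite -zv adjC xz.
have [noiso|[v]] := set_0Vmem (iso X); last first.
  rewrite !inE => /andP[Xv /eqP isov]; exists v => //.
  rewrite cardNX // isov cards0 add2n add1n !ltnS.
  rewrite (cardsD1 v (iso X)) !inE Xv isov eqxx add1n ltnS.
  apply: subset_leq_card; apply/subsetP => x isox.
  have [] := boolP (N x :&: X == set0) => [|isoxX].
    by move: isox; rewrite !inE negb_or -!andbA => /and4P[-> _ -> _] ->.
  by have [z] := isoX' v x Xv isoxX isox; rewrite isov inE.
have Nn0 x : x \in X -> N x :&: X != set0.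
  by move=> Xx; apply: contraFneq (in_set0 x) => isox; rewrite -noiso !inE Xx isox eqxx.
have [/existsP[l /andP[Xl /cards1P[v Nl]]]|noleaf] :=
    boolP [exists l, (l \in X) && (#|N l :&: X| == 1)].
  have /setIP[vl Xv] : v \in N l :&: X by rewrite Nl inE.
  rewrite inE in vl; exists v => //; rewrite noiso cards0 addn0 cardNX //.
  have lNv : l \in N v :&: X by rewrite !inE adjC vl.
  rewrite add2n (cardsD1 l (N v :&: X)) lNv add1n !ltnS.
  (* The leaf [l] leads to nothing but [v], and every other neighbour [z] of [v] leads to at most
     one vertex besides [v]. *)
  apply: leq_trans (_ : #|\bigcup_(z in (N v :&: X) :\ l) ((N z :&: X) :\ v)| <= _).
    apply: subset_leq_card; apply/subsetP => x isox.
    have Xx : x \in X by move: isox; rewrite !inE => /andP[/andP[]].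
    have [z Nz xz] := isoX' v x Xv (Nn0 x Xx) isox.
    apply/bigcupP; exists z => //; rewrite in_setD1 Nz andbT.
    apply: contraTneq xz => ->; rewrite in_setD1 Nl inE.
    by case: eqP.
  apply: leq_trans (card_bigcup_le _ _) _.
  rewrite -sum1_card; apply: leq_sum => z /setD1P[_ /setIP[vz Xz]].
  rewrite inE in vz.
  by have := degX z Xz; rewrite (cardsD1 v) !inE adjC vz Xv.
exists x0 => //; rewrite noiso cards0 addn0 cardNX //.
have deg2 x : x \in X -> #|N x :&: X| = 2.
  move=> Xx; apply/eqP; rewrite eqn_leq degX //= ltn_neqAle card_gt0 Nn0 //.
  rewrite andbT eq_sym; apply: contraNN noleaf => deg1; apply/existsP; exists x.
  by rewrite Xx.
rewrite deg2 // add2n !ltnS; apply: (@leq_trans 0) => //.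
(* All degrees being 2, both neighbours of a newly isolated [x] would be adjacent to [x0], which
   closes a 4-cycle. *)
rewrite leqn0 cards_eq0 -subset0; apply/subsetP => x isox.
have Xx : x \in X by move: isox; rewrite !inE => /andP[/andP[]].
have /cards2P[z [z' [zz' Nx]]] := introT eqP (deg2 x Xx).
move: isox; rewrite !inE negb_or -!andbA => /and4P[xv nvx _ /eqP isox].
have inN y : y \in N x :&: X -> adj x y && adj x0 y.
  rewrite !inE => /andP[xy Xy]; rewrite xy /=; apply: contraT => nvy.
  have /setP/(_ y) := isox; rewrite !inE xy Xy (negbTE nvy) orbF andbT.
  by case: eqP => // yv; move: nvx; rewrite -yv adjC xy.
have /inN/andP[xz vz] : z \in N x :&: X by rewrite Nx !inE eqxx.
have /inN/andP[xz' vz'] : z' \in N x :&: X by rewrite Nx !inE eqxx orbT.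
by case/eqP: zz'; apply: (common_nbhd xv).
Qed.
End Graph.

(** * Structure of an optimal minimum dominating set *)

Section MinDom.
Set Implicit Arguments.
Unset Strict Implicit.

Variables (V : finType) (adj : rel V).
Hypotheses (adjC : symmetric adj) (adjN : irreflexive adj).
Hypothesis noC4 : ~ has_C4 adj.
Hypothesis cub : cubic adj.
Local Notation N := (nbhd adj).
Local Notation e := (edges adj).

Lemma min_dominating_set : exists S : {set V},
  [/\ dominating adj S, forall D, dominating adj D -> #|S| <= #|D|
    & forall D, dominating adj D -> #|D| = #|S| -> e S S <= e D D].
Proof.
have domT : dominating adj setT by apply/domP => x; rewrite inE.
case: (arg_minnP (fun S : {set V} => #|S|) domT) => S0 domS0 minS0.
pose P := [pred S : {set V} | dominating adj S && (#|S| == #|S0|)].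
have PS0 : P S0 by rewrite /= domS0 eqxx.
case: (arg_minnP (fun S : {set V} => e S S) PS0) => S /andP[domS /eqP cS] minS.
exists S; split=> // [D /minS0|D domD cD]; first by rewrite cS.
by apply: minS; rewrite /= domD cD cS eqxx.
Qed.

(* If [v] is not isolated in [G[S]], it may be traded for any set dominating
   its private neighbours; minimality of [S] and then of [e S S] forbids
   trading it for nothing or for a single private neighbour. *)
Lemma min_dominating_matched (S : {set V}) v :
    dominating adj S -> (forall D, dominating adj D -> #|S| <= #|D|) ->
    (forall D, dominating adj D -> #|D| = #|S| -> e S S <= e D D) ->
    v \in S -> N v :&: S != set0 ->
  [/\ #|N v :&: S| = 1, forall x, x \notin S -> adj v x -> N x :&: S = [set v]
    & {in N v :\: S &, forall x y, ~~ adj x y}].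
Proof.
move=> domS minS minE Sv nSv.
pose Pr := [set x | (x \notin S) && (N x :&: S == [set v])].
(* Only the private neighbours of [v] depend on [v]; [v] itself stays dominated by its neighbour in
   [S]. *)
have trade (D : {set V}) :
    {in Pr, forall x, x \notin D -> exists2 y, y \in D & adj x y} ->
    dominating adj (S :\ v :|: D).
  move=> domD; apply/domP => x; rewrite !inE negb_or negb_and negbK.
  case/andP=> xS Dx; have [->|xv] := eqVneq x v.
    have /set0Pn[y /setIP[vy Sy]] := nSv; rewrite inE in vy.
    exists y => //; rewrite !inE Sy andbT; apply/orP; left.
    by apply: contraTneq vy => ->; rewrite adjN.
  rewrite (negPf xv) /= in xS; have [y Sy xy] := domP _ _ domS x xS.
  have [Nx|] := eqVneq (N x :&: S) [set v].
    have [|z Dz xz] := domD x _ Dx; first by rewrite inE xS Nx eqxx.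
    by exists z; rewrite // inE Dz orbT.
  rewrite eqEsubset negb_and => /orP[/subsetPn[z]|].
    rewrite !inE => /andP[xz Sz] zv.
    by exists z => //; rewrite !inE zv Sz.
  rewrite sub1set !inE Sv andbT => nxv; exists y => //.
  by rewrite !inE Sy andbT; apply/orP; left; apply: contraNneq nxv => <-.
have PrN : Pr \subset N v :\: S.
  apply/subsetP => x; rewrite !inE => /andP[-> /eqP/setP/(_ v)].
  by rewrite !inE eqxx adjC => /andP[].
have [Pr0|[y Pry]] := set_0Vmem Pr.
  have /minS : dominating adj (S :\ v :|: set0).
    by apply: trade => x; rewrite Pr0 inE.
  by rewrite setU0 (cardsD1 v S) Sv add1n ltnn.
have [y' Pry' /norP[y'y nyy']] : exists2 y', y' \in Pr & ~~ ((y' == y) || adj y y').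
  apply/exists_inP; apply: contraT => /exists_inPn cov.
  have /setDP[vy Sy] := subsetP PrN _ Pry; rewrite inE in vy.
  have Ny : N y :&: S = [set v] by move: Pry; rewrite inE => /andP[_ /eqP].
  have Dy : y \notin S :\ v by rewrite inE (negPf Sy) andbF.
  have domD : dominating adj (S :\ v :|: [set y]).
    apply: trade => x Prx; rewrite inE => xy; exists y; rewrite ?inE //.
    by have := cov x Prx; rewrite negbK (negPf xy) adjC.
  have dis z (A : {set V}) : z \notin A -> [disjoint A & [set z]].
    by move=> Az; rewrite disjoint_sym disjoints1.
  have cardD : #|S :\ v :|: [set y]| = #|S|.
    by rewrite setUC cardsU1 Dy (cardsD1 v S) Sv.
  have := minE _ domD cardD.
  have e1 z : e [set z] [set z] = 0.
    by apply: edges_eq0 => a b; rewrite !inE => /eqP-> /eqP->; rewrite adjN.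
  rewrite edges_sqU ?dis // e1 addn0.
  rewrite -[X in e X X <= _](setD1K Sv) setUC edges_sqU ?dis ?setD11 //.
  rewrite e1 addn0 leq_add2l leq_pmul2l // edgesC // edges1 [X in _ <= X]edgesC // edges1.
  (* The private vertex [y] has no neighbour in [S :\ v] whereas [v] has one, so this trade would
     lower [e S S]. *)
  have -> : N y :&: (S :\ v) = set0 by rewrite setIDA Ny setDv.
  rewrite cards0 leqn0 cards_eq0 => /eqP Nv0; case/set0Pn: nSv => z /setIP[vz Sz].
  rewrite inE in vz; have zv : z != v by apply: contraTneq vz => ->; rewrite adjN.
  by have := in_set0 z; rewrite -Nv0 !inE Sz vz zv.
have sPr : [set y; y'] \subset Pr by rewrite subUset !sub1set Pry.
have c2 : #|[set y; y']| = 2 by rewrite cards2 eq_sym y'y.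
(* At least one of the three neighbours of [v] lies in [S], so the two private ones are all those
   outside [S]. *)
have cN : #|N v :&: S| + #|N v :\: S| = 3 by rewrite cardsID; exact: cub.
have c1 : 0 < #|N v :&: S| by rewrite card_gt0.
have NE : [set y; y'] = N v :\: S.
  apply/eqP; rewrite eqEcard (subset_trans sPr PrN) c2; lia.
split.
- by move: cN; rewrite -NE c2; lia.
- move=> x Sx vx; have : x \in N v :\: S by rewrite !inE Sx.
  by rewrite -NE => /(subsetP sPr); rewrite inE => /andP[_ /eqP].
- move=> a b; rewrite -NE !inE => /pred2P[] -> /pred2P[] ->; rewrite ?adjN //.
  by rewrite adjC.
Qed.

End MinDom.

(** * Extending [I] and [B] to a small independent dominating set *)

Section Extension.
Set Implicit Arguments.
Unset Strict Implicit.

Variables (V : finType) (adj : rel V).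
Hypotheses (adjC : symmetric adj) (adjN : irreflexive adj).
Hypothesis noC4 : ~ has_C4 adj.
Hypothesis cub : cubic adj.
Local Notation N := (nbhd adj).
Local Notation e := (edges adj).

Variables I B U W : {set V}.
Hypothesis dIU : [disjoint I & U].
Hypothesis dIW : [disjoint I & W].
Hypothesis dBU : [disjoint B & U].
Hypothesis dUW : [disjoint U & W].
Hypothesis dIB : [disjoint I & B].
Hypothesis indepIB : independent adj (I :|: B).
Hypothesis domB : forall x, x \notin I :|: B :|: U :|: W ->
  exists2 y, y \in B & adj x y.
Hypothesis NU_IB : {in U & I :|: B, forall x y, ~~ adj x y}.
Hypothesis NU_UW : {in U, forall x, #|N x :&: U| + #|N x :&: W| <= 2}.
Hypothesis NI : {in I, forall s, N s \subset W}.
Hypothesis NW_B : {in W & B, forall x y, ~~ adj x y}.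
Hypothesis NW_I : {in W, forall w, N w :&: I != set0}.

(* [c w] is twice the share of the [U0]-neighbours of [w] credited to each
   [I]-neighbour of [w]; a neighbour in [U1] cancels one in [U0], since [w] may
   then already be dominated from [U1].  [g s] is twice the saving obtained by
   replacing [s] with its private neighbours (truncated at [0]). *)
Let U0 := [set u in U | N u :&: U == set0].
Let U1 := U :\: U0.
Let t w := #|N w :&: U0|.
Let c w := if #|N w :&: I| == 1 then 2 * t w - 2 * #|N w :&: U1| else t w.
Let g s := \sum_(w in N s) c w - 4.
Let owns s w := (w \in W) && (N w :&: I == [set s]).
Let near w w' := adj w w' || [exists u in U0, adj u w && adj u w'].
(** Without conflicts, no vertex loses two neighbours in [I], vertices owned by distinct removed
    vertices may be taken together, and none of [U0] is covered by two of them. *)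
Let conflict s s' := [&& s != s', s \in I, s' \in I &
  [exists w in N s, exists w' in N s',
    (w == w') || [&& owns s w, owns s' w' & near w w']]].

Lemma card_nbhd x : #|N x| = 3. Proof. exact: cub. Qed.

Lemma isolated_sub : U0 \subset U. Proof. by apply/subsetP => x; rewrite inE => /andP[]. Qed.

Lemma card_IUW w : #|N w :&: I| + t w + #|N w :&: U1| <= 3.
Proof.
rewrite -(card_nbhd w) -(cardsID I (N w)) -addnA leq_add2l.
rewrite -(cardsID U (N w :\: I)) -[leqLHS]addn0 leq_add //.
rewrite -(cardsID U0 ((N w :\: I) :&: U)) leq_add //; apply: subset_leq_card;
  apply/subsetP => x; rewrite !inE.
  move=> /andP[-> /andP[Ux ->]]; rewrite Ux /=.
  by rewrite andbT (disjointFl dIU).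
by move=> /andP[-> /andP[-> Ux]]; rewrite Ux (disjointFl dIU).
Qed.

Lemma nbhd_I_gt0 w : w \in W -> 0 < #|N w :&: I|.
Proof. by move=> Ww; rewrite card_gt0 NW_I. Qed.

Lemma conflict_sym : symmetric conflict.
Proof.
suff imp s s' : conflict s s' -> conflict s' s by move=> s s'; apply/idP/idP; exact: imp.
case/and4P=> ss' Is Is' /exists_inP[w sw /exists_inP[w' sw' h]].
rewrite /conflict eq_sym ss' Is Is' /=; apply/exists_inP; exists w' => //.
apply/exists_inP; exists w => //; case/orP: h => [/eqP->|/and3P[ow ow']].
  by rewrite eqxx.
rewrite ow ow' /= /near adjC => /orP[->|/exists_inP[u uU h]]; first by rewrite orbT.
by apply/or3P/Or33/exists_inP; exists u => //; rewrite andbC.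
Qed.

Lemma conflict_irr : irreflexive conflict.
Proof. by move=> s; rewrite /conflict eqxx. Qed.

(* A conflict with [s] is read off the second edge leaving some [w] in [N s]:
   there are six such edges, and each determines the conflicting vertex. *)
Lemma card_conflict s : s \in I -> #|[set s' in I | conflict s s']| <= 6.
Proof.
move=> Is.
(* The conflicts read off the edge from [w] to [x]: [x] is [s'] itself, or is owned by [s'], or lies
   in [U0] and leads to a vertex owned by [s']. *)
pose F w x := [set s' in I | [|| x == s', (x \in W) && (N x :&: I == [set s'])
  | (x \in U0) && [exists w' in (N x :&: W) :\ w, N w' :&: I == [set s']]]].
apply: leq_trans (_ : #|\bigcup_(w in N s) \bigcup_(x in N w :\ s) F w x| <= _).
  apply: subset_leq_card; apply/subsetP => s'; rewrite inE => /andP[_].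
  case/and4P=> ss' _ Is' /exists_inP[w sw /exists_inP[w' sw' h]].
  apply/bigcupP; exists w => //; rewrite !inE in sw sw'.
  have s'w' : s' \in N w' by rewrite inE adjC.
  have sw'F : w = w' -> s' \in \bigcup_(x in N w :\ s) F w x.
    move=> ->; apply/bigcupP; exists s'; first by rewrite in_setD1 eq_sym ss'.
    by rewrite inE Is' eqxx.
  case/orP: h => [/eqP/sw'F //|/and3P[/andP[Ww /eqP ow] /andP[Ww' /eqP ow']]].
  have nWI x : x \in W -> x != s.
    by apply: contraTneq => ->; rewrite (disjointFr dIW).
  case/orP=> [ww'|/exists_inP[u U0u /andP[uw uw']]].
    apply/bigcupP; exists w'; first by rewrite !inE nWI.
    by rewrite inE Is' Ww' ow' eqxx orbT.
  have [/sw'F //|ww'] := eqVneq w w'.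
  apply/bigcupP; exists u.
    rewrite !inE adjC uw andbT; apply: contraTneq U0u => ->.
    by apply/negP => /(subsetP isolated_sub); rewrite (disjointFr dIU).
  rewrite inE Is' U0u /=; apply/or3P/Or33/exists_inP; exists w'.
    by rewrite !inE eq_sym ww' uw'.
  by rewrite ow'.
apply: leq_trans (card_bigcup_le _ _) _.
rewrite (_ : 6 = \sum_(w in N s) 2); last by rewrite sum_nat_const card_nbhd.
apply: leq_sum => w sw; apply: leq_trans (card_bigcup_le _ _) _.
rewrite (_ : 2 = \sum_(x in N w :\ s) 1); last first.
  rewrite sum1_card; have := card_nbhd w; rewrite (cardsD1 s) !inE adjC.
  by rewrite inE in sw; rewrite sw add1n => -[].
apply: leq_sum => x; rewrite !inE => /andP[xs wx].
apply/card_le1_eqP => a b; rewrite in_set => /andP[Ia ha]; rewrite in_set => /andP[Ib hb].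
(* The three kinds exclude one another, because [I], [W] and [U0] are pairwise disjoint. *)
have Wx_I : x \in W -> x \in I -> False by move=> Wx; rewrite (disjointFl dIW).
have U0x_I : x \in U0 -> x \in I -> False.
  by move/(subsetP isolated_sub) => Ux; rewrite (disjointFl dIU).
have U0x_W : x \in U0 -> x \in W -> False.
  by move/(subsetP isolated_sub) => Ux; rewrite (disjointFr dUW).
case/or3P: ha => [/eqP xa|/andP[Wx /eqP xa]|/andP[U0x /exists_inP[w1 w1P /eqP w1a]]];
case/or3P: hb => [/eqP xb|/andP[Wx' /eqP xb]|/andP[U0x' /exists_inP[w2 w2P /eqP w2b]]].
- by rewrite -xa.
- by case: (Wx_I Wx'); rewrite xa.
- by case: (U0x_I U0x'); rewrite xa.
- by case: (Wx_I Wx); rewrite xb.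
- exact: set1_inj (etrans (esym xb) xa).
- by case: (U0x_W U0x' Wx).
- by case: (U0x_I U0x); rewrite xb.
- by case: (U0x_W U0x Wx').
(* A vertex of [U0] has at most two neighbours in [W]; one of them is [w], so the other end of the
   path is determined. *)
- have Ww : w \in W by apply: (subsetP (NI Is)).
  have /card_le1_eqP/(_ w1 w2 w1P w2P) w21 : #|(N x :&: W) :\ w| <= 1.
    have := NU_UW (subsetP isolated_sub _ U0x); rewrite (cardsD1 w (N x :&: W)).
    rewrite in_setI in_nbhd (adjC x) wx Ww; clear; lia.
  by apply: set1_inj; rewrite -w1a -w2b w21.
Qed.

(** Each [w] in [W] hands out [c w] to every neighbour in [I]. With at least two such neighbours
    this totals at least [2 * t w]; with one, the deficit is paid by the edges to [U1]. The 4 per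
    vertex of [I] makes up for the subtraction in [g]. *)
Lemma gain_total : 2 * e U0 W <= 2 * e U1 W + 4 * #|I| + \sum_(s in I) g s.
Proof.
apply: leq_trans (_ : 2 * e U1 W + \sum_(s in I) \sum_(w in N s :&: W) c w <= _).
  rewrite sum_nbhd // (edgesC adjC U0) (edgesC adjC U1) /edges !big_distrr -big_split /=.
  apply: leq_sum => w Ww; have := card_IUW w; have := nbhd_I_gt0 Ww.
  rewrite -/(t w) /c; case: eqP => [->|]; first by clear; lia.
  by clear; move: #|N w :&: I| (t w) #|N w :&: U1| => i k l; nia.
rewrite -addnA leq_add2l mulnC -sum_nat_const -big_split /=.
apply: leq_sum => s Is; rewrite (setIidPl (NI Is)) /g; clear; lia.
Qed.

Lemma budget_nonisolated : e U U + e U1 W <= 2 * #|U1|.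
Proof.
rewrite mulnC -sum_nat_const {1}/edges (big_setID U0) /= (setIidPr isolated_sub).
rewrite big1 ?add0n => [|u]; last by rewrite inE => /andP[_ /eqP->]; rewrite cards0.
rewrite /edges -big_split /=; apply: leq_sum => u /setDP[Uu _]; exact: NU_UW.
Qed.

(** Neighbours inside [U] of a vertex of [U1] are again in [U1], so [U1] has no isolated vertices
    and the penalty term for them vanishes. *)
Lemma dominate_nonisolated : exists D : {set V}, [/\ D \subset U1, independent adj D,
  forall x, x \in U1 -> x \notin D -> exists2 y, y \in D & adj x y
  & 2 * #|D| <= #|U1|].
Proof.
have [|D [sD iD domD cD]] := @indep_dom_degree_le2 V adj adjC adjN noC4 U1.
  move=> x /setDP[Ux _]; apply: leq_trans (NU_UW Ux).
  by rewrite (leq_trans _ (leq_addr _ _)) // subset_leq_card // setIS // subsetDl.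
exists D; split=> //; apply: leq_trans cD _.
rewrite -[leqRHS]addn0 leq_add2l leqn0 cards_eq0 -subset0; apply/subsetP => x.
rewrite inE => /andP[U1x /eqP isox]; have /setDP[Ux] := U1x.
rewrite inE Ux /= => /set0Pn[y /setIP[xy Uy]].
suff : y \in N x :&: U1 by rewrite isox in_set0.
rewrite in_setI xy in_setD Uy andbT inE Uy /=.
by apply/set0Pn; exists x; rewrite in_setI Ux andbT (in_nbhdC adjC).
Qed.

(** * Replacing a conflict-free set [R] of vertices of [I] *)

Section Core.

Variables R D : {set V}.
Hypothesis sRI : R \subset [set s in I | 0 < g s].
Hypothesis cfR : {in R &, forall s s', ~~ conflict s s'}.
Hypothesis sDU1 : D \subset U1.
Hypothesis iD : independent adj D.
Hypothesis domD : forall x, x \in U1 -> x \notin D -> exists2 y, y \in D & adj x y.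

(** The most profitable replacements. They can all be forced into the core, since their neighbours
    lie in [R] and [U0], which the core avoids. *)
Let W2 := [set w in W | [exists s in R, N w :&: I == [set s]] && (t w == 2)].
Let C := (I :\: R) :|: B :|: D :|: W2.

Lemma removed_I s : s \in R -> s \in I.
Proof. by move/(subsetP sRI); rewrite inE => /andP[]. Qed.

Lemma core_avoids y : y \in R :|: U0 -> y \notin C.
Proof.
rewrite /C !in_setU => Ry; apply/negP.
case/orP=> [/orP[/orP[/setDP[Iy NRy]|By]|Dy]|].
- move: Ry; rewrite (negPf NRy) => /(subsetP isolated_sub).
  by rewrite (disjointFr dIU).
- case/orP: Ry => [/removed_I|/(subsetP isolated_sub)]; first by rewrite (disjointFl dIB).
  by rewrite (disjointFr dBU).
- have /setDP[Uy NU0y] := subsetP sDU1 y Dy; move: Ry; rewrite (negPf NU0y) orbF.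
  by move/removed_I; rewrite (disjointFl dIU).
- rewrite inE => /andP[Wy _]; case/orP: Ry => [/removed_I|/(subsetP isolated_sub)].
    by rewrite (disjointFl dIW).
  by rewrite (disjointFl dUW).
Qed.

(** The owner in [R] and the two neighbours in [U0] exhaust the degree 3 of [w]. *)
Lemma nbhd_W2 w y : w \in W2 -> adj w y -> y \in R :|: U0.
Proof.
rewrite inE => /and3P[Ww /exists_inP[s Rs /eqP Nw] /eqP tw] wy.
have /eqP NE : (N w :&: I) :|: (N w :&: U0) == N w.
  rewrite eqEcard subUset !subsetIl card_nbhd cardsU Nw cards1 -/(t w) tw.
  rewrite (_ : _ :&: _ = set0) ?cards0 //.
  apply/setP => x; rewrite !in_setI in_set0 in_set1.
  case: eqP => // ->; rewrite [s \in U0](contraFF (subsetP isolated_sub s)) ?andbF //.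
  by rewrite (disjointFr dIU (removed_I Rs)).
have : y \in N w by rewrite in_nbhd.
rewrite -NE Nw in_setU in_set1 in_setI in_setU.
by case/orP=> [/eqP->|/andP[_ ->]]; rewrite ?Rs ?orbT.
Qed.

Lemma indep_core : independent adj C.
Proof.
have iIB : independent adj (I :\: R :|: B).
  by apply: independentS indepIB; rewrite setSU ?subsetDl.
have iIBD : independent adj (I :\: R :|: B :|: D).
  apply: independentU => // x y IBx Dy; rewrite adjC NU_IB //.
    by have /setDP[] := subsetP sDU1 y Dy.
  by apply: subsetP IBx; rewrite setSU ?subsetDl.
apply: independentU => //.
  apply/indepP => x y W2x W2y; apply/negP => /(nbhd_W2 W2x) /core_avoids.
  by rewrite in_setU W2y orbT.
move=> x y Cx W2y; apply/negP; rewrite adjC => /(nbhd_W2 W2y) /core_avoids.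
by rewrite inE Cx.
Qed.

(** As [M] contains [I :\: R], all neighbours of [w] in [I] were removed; two of them would be in
    conflict through [w]. *)
Lemma owner_W (M : {set V}) w : C \subset M -> independent adj M ->
  w \in M -> w \in W -> exists2 s, s \in R & N w :&: I = [set s].
Proof.
move=> /subsetP sCM /indepP iM Mw Ww.
have inR s : s \in N w :&: I -> s \in R.
  case/setIP; rewrite in_nbhd => ws Is; apply: contraT => NRs.
  by move: (iM w s Mw); rewrite sCM ?ws; [move/(_ isT)|rewrite /C !in_setU in_setD NRs Is].
have /set0Pn[s Nws] := NW_I Ww; exists s; first exact: inR.
apply/setP => s'; rewrite in_set1; apply/idP/eqP => [Nws'|-> //].
apply/eqP; apply: contraT => s's; have := cfR (inR _ Nws) (inR _ Nws').
case/negP; have /setIP[ws Is] := Nws; have /setIP[ws' Is'] := Nws'.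
rewrite in_nbhd adjC in ws; rewrite in_nbhd adjC in ws'.
rewrite /conflict eq_sym s's Is Is' /=; apply/exists_inP; exists w; rewrite ?in_nbhd //.
by apply/exists_inP; exists w; rewrite ?in_nbhd ?eqxx.
Qed.

Lemma conflict_near s s' w w' : s \in R -> s' \in R -> s != s' ->
  w \in W -> N w :&: I = [set s] -> w' \in W -> N w' :&: I = [set s'] ->
  ~~ near w w'.
Proof.
move=> Rs Rs' ss' Ww Nw Ww' Nw'; apply/negP => h; case/negP: (cfR Rs Rs').
rewrite /conflict ss' !removed_I //=.
have sw : w \in N s.
  by rewrite (in_nbhdC adjC); apply: (subsetP (subsetIl _ I)); rewrite Nw set11.
have sw' : w' \in N s'.
  by rewrite (in_nbhdC adjC); apply: (subsetP (subsetIl _ I)); rewrite Nw' set11.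
apply/exists_inP; exists w => //; apply/exists_inP; exists w' => //.
by rewrite /owns Ww Nw Ww' Nw' !eqxx h orbT.
Qed.

(** Used to show that no removed vertex returns. If [s] is the only neighbour of [w] in [I], then
    [t w] is at most 1, for otherwise [w] is in [W2]; and the vertex of [M1] blocking [w] can only
    lie in [U1], which cancels the credit. With two neighbours in [I], the degree leaves room for
    only one in [U0]. *)
Lemma credit_le1 s w (M1 : {set V}) : C \subset M1 -> M1 \subset ~: (R :|: U0) ->
    independent adj M1 ->
    (forall x, x \in ~: (R :|: U0) -> x \notin M1 -> exists2 y, y \in M1 & adj x y) ->
    s \in R -> [disjoint N s & M1] -> w \in N s -> c w <= 1.
Proof.
move=> sCM sM iM maxM Rs dsM sw; have Is := removed_I Rs; have Ww := subsetP (NI Is) w sw.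
have := card_IUW w; have := nbhd_I_gt0 Ww; rewrite -/(t w) /c.
case: eqP => [/eqP/cards1P[s1 Nw]|]; last by clear; lia.
have Ns : s \in N w :&: I by rewrite in_setI Is andbT (in_nbhdC adjC).
move: Ns; rewrite Nw in_set1 => /eqP ?; subst s1; rewrite cards1.
have NMw : w \notin M1 by rewrite (disjointFr dsM).
have tw2 : t w <> 2.
  move=> tw; case/negP: NMw; apply: (subsetP sCM); rewrite /C in_setU; apply/orP; right.
  rewrite inE Ww tw eqxx andbT /=; apply/exists_inP; exists s; rewrite ?Nw //.
have [|y My wy] := maxM w _ NMw.
  rewrite in_setC in_setU negb_or; apply/andP; split.
    by apply/negP => /removed_I; rewrite (disjointFl dIW).
  by apply/negP => /(subsetP isolated_sub); rewrite (disjointFl dUW).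
have := subsetP sM y My; rewrite in_setC in_setU negb_or => /andP[NRy NU0y].
have bad b : b \in B -> adj y b -> False.
  move=> Bb; apply/negP; apply: (indepP _ _ iM) => //; apply: (subsetP sCM).
  by rewrite /C !in_setU Bb orbT.
have [Uy|NUy] := boolP (y \in U).
  suff : 0 < #|N w :&: U1| by move: tw2; clear; lia.
  by rewrite card_gt0; apply/set0Pn; exists y; rewrite in_setI in_setD Uy NU0y in_nbhd wy.
exfalso; have [Iy|NIy] := boolP (y \in I).
  have : y \in N w :&: I by rewrite in_setI Iy in_nbhd wy.
  by rewrite Nw in_set1 => /eqP ys; rewrite ys Rs in NRy.
have [Wy|NWy] := boolP (y \in W).
  have [s' Rs' Ny] := owner_W sCM iM My Wy.
  have [ss'|ss'] := eqVneq s s'.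
    have : s \in N y :&: I by rewrite Ny ss' set11.
    rewrite in_setI (in_nbhdC adjC) => /andP[sy _].
    by move: My; rewrite (disjointFr dsM).
  by have /negP[] := conflict_near Rs Rs' ss' Ww Nw Wy Ny; rewrite /near wy.
have [By|NBy] := boolP (y \in B); first by case/negP: (NW_B Ww By).
have [|b Bb yb] := domB (x := y).
  by rewrite !in_setU (negPf NIy) (negPf NBy) (negPf NUy).
exact: bad yb.
Qed.

(** Checked separately for each of the three [w] in [N s]: one left out of [Mw] is not in [W2], so
    its credit is at most 2. *)
Lemma gain_owner s (Mw : {set V}) : s \in R -> Mw \subset W ->
    {in Mw, forall w, #|N w :&: I| = 1} -> W2 \subset Mw ->
  g s + 2 * #|N s :&: Mw| <= 2 + 2 * \sum_(w in N s :&: Mw) t w.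
Proof.
move=> Rs sMW i1 sW2; have Is := removed_I Rs.
have sumM f : \sum_(w in N s :&: Mw) f w = \sum_(w in N s) (w \in Mw) * f w.
  rewrite (eq_bigl [pred w in N s | w \in Mw]) => [|w]; last by rewrite in_setI.
  by rewrite big_mkcondr; apply: eq_bigr => w _; case: (w \in Mw); rewrite ?mul1n.
(* Since [g s] is positive, its truncated subtraction is exact, and 6 - 4 gives the constant 2. *)
suff : \sum_(w in N s) c w + 2 * #|N s :&: Mw| <=
       6 + 2 * \sum_(w in N s :&: Mw) t w.
  move: (subsetP sRI s Rs); rewrite inE Is /= /g; clear; lia.
rewrite -sum1_card !sumM !big_distrr /= (_ : 6 = \sum_(w in N s) 2); last first.
  by rewrite sum_nat_const card_nbhd.
rewrite -!big_split; apply: leq_sum => w sw /=.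
have Ww := subsetP (NI Is) w sw; have := card_IUW w; have := nbhd_I_gt0 Ww.
rewrite -/(t w) /c; have [Mww|NMw] := boolP (w \in Mw).
  by rewrite i1 //= ; clear; lia.
case: eqP => [/eqP/cards1P[s1 Nw]|]; last by clear; lia.
suff : t w <> 2 by clear; lia.
move=> tw; case/negP: NMw; apply: (subsetP sW2); rewrite inE Ww tw eqxx andbT /=.
apply/exists_inP; exists s => //; rewrite Nw eq_sym.
have : s \in N w :&: I by rewrite in_setI Is andbT (in_nbhdC adjC).
by rewrite Nw in_set1 => /eqP->.
Qed.

Lemma core_extension : exists M : {set V},
  [/\ dominating adj M, independent adj M
    & 2 * #|M| + \sum_(s in R) g s <= 2 * (#|I| + #|B| + #|D| + #|U0|)].
Proof.
have sC : C \subset ~: (R :|: U0).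
  by apply/subsetP => y Cy; rewrite in_setC; apply: contraL Cy; exact: core_avoids.
(* Two stages: [R] and [U0] are first held back so that the neighbours of [R] have priority, and
   then everything is allowed so that [M] dominates. *)
have [M1 [sCM1 sM1 iM1 maxM1]] := maximal_independent adjC adjN indep_core sC.
have [M [sM1M _ iM maxM]] := maximal_independent adjC adjN iM1 (subsetT M1).
have sCM := subset_trans sCM1 sM1M.
have NM x y : x \in M -> y \in M -> adj x y -> False.
  by move=> Mx My; apply/negP; apply: (indepP _ _ iM).
exists M; split=> //; first by apply/domP => x; apply: maxM; rewrite in_setT.
(* If [s] returned, none of its neighbours would be chosen; three credits of at most 1 stay below 4,
   so [g s] would vanish. *)
have NMR s : s \in R -> s \notin M.
  move=> Rs; apply/negP => Ms; have := subsetP sRI s Rs; rewrite inE => /andP[Is].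
  have dsM : [disjoint N s & M1].
    rewrite disjoint_subset; apply/subsetP => w; rewrite in_nbhd inE => sw.
    by apply/negP => /(subsetP sM1M) Mw; apply: (NM s w).
  rewrite /g subn_gt0; apply/negP; rewrite -leqNgt; apply: (@leq_trans 3) => //.
  apply: leq_trans (_ : \sum_(w in N s) 1 <= _); last by rewrite sum1_card card_nbhd.
  by apply: leq_sum => w; apply: credit_le1 maxM1 Rs dsM.
set Mw := M :&: W.
have ownM w : w \in Mw -> exists2 s, s \in R & N w :&: I = [set s].
  by case/setIP; apply: owner_W.
have cardM : #|M| + #|R| <= #|I| + #|B| + #|D| + #|M :&: U0| + #|Mw|.
  have -> : #|I| = #|R| + #|I :\: R|.
    have sRI' : R \subset I by apply/subsetP => s; exact: removed_I.
    by rewrite -(cardsID R I) (setIidPr sRI').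
  rewrite addnC -!addnA leq_add2l !addnA.
  apply: leq_trans (_ : #|I :\: R :|: B :|: D :|: (M :&: U0) :|: Mw| <= _).
    apply: subset_leq_card; apply/subsetP => x Mx; rewrite !inE Mx /=.
    have [Ix|NIx] := boolP (x \in I).
      by rewrite (contraTN (NMR x) Mx).
    have [Bx|NBx] := boolP (x \in B); first by rewrite !orbT.
    have [Wx|NWx] := boolP (x \in W); first by rewrite !orbT.
    have [Ux|NUx] := boolP (x \in U); last first.
      have [|b Bb xb] := domB (x := x).
        by rewrite !in_setU (negPf NIx) (negPf NBx) (negPf NUx).
      case: (NM x b) => //; apply: (subsetP sCM).
      by rewrite /C !in_setU Bb orbT.
    have [U0x|NU0x] := boolP (x \in U0).
      by move: U0x; rewrite inE Ux /= => ->; rewrite !orbT.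
    suff -> : x \in D by rewrite !orbT.
    apply: contraT => NDx; have [|y Dy xy] := domD _ NDx.
      by rewrite in_setD NU0x.
    case: (NM x y) => //; apply: (subsetP sCM).
    by rewrite /C !in_setU Dy !orbT.
  by rewrite (leq_trans (leq_card_setU _ _)) ?leq_add2r //
       (leq_trans (leq_card_setU _ _)) ?leq_add2r //
       (leq_trans (leq_card_setU _ _)) ?leq_add2r // leq_card_setU.
(* A vertex of [U0] outside [M] has at most one neighbour in [Mw]: two with the same owner close a
   4-cycle, two with distinct owners give a conflict. *)
have coverU0 : #|M :&: U0| + \sum_(w in Mw) t w <= #|U0|.
  have -> : \sum_(w in Mw) t w = e U0 Mw by rewrite edgesC.
  rewrite setIC -!sum1_card /edges.
  rewrite (eq_bigl [pred u in U0 | u \in M]) => [|u]; last by rewrite in_setI.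
  rewrite big_mkcondr -big_split /=; apply: leq_sum => u U0u.
  have Uu := subsetP isolated_sub u U0u.
  have [Mu|_] := boolP (u \in M).
    rewrite (_ : N u :&: Mw = set0) ?cards0 //; apply/setP => w; rewrite in_set0.
    by apply/negP => /setIP[uw /setIP[Mww _]]; rewrite in_nbhd in uw; apply: (NM u w).
  rewrite add0n; apply/card_le1_eqP => w' w /setIP[uw' Mw'] /setIP[uw Mww].
  rewrite !in_nbhd in uw uw'.
  have [s Rs Nw] := ownM w Mww; have [s' Rs' Nw'] := ownM w' Mw'.
  have sw : s \in N w :&: I by rewrite Nw set11.
  have sw' : s' \in N w' :&: I by rewrite Nw' set11.
  rewrite !in_setI !in_nbhd adjC in sw; rewrite !in_setI !in_nbhd adjC in sw'.
  have [/andP[{}sw Is] /andP[{}sw' _]] := (sw, sw').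
  have [ss'|ss'] := eqVneq s s'.
    rewrite -ss' in sw'; apply: (common_nbhd adjC adjN noC4 (a := s) (c := u)) => //.
    by apply: contraTneq Uu => <-; rewrite (disjointFr dIU).
  have /setIP[_ Ww] := Mww; have /setIP[_ Ww'] := Mw'.
  case/negP: (conflict_near Rs Rs' ss' Ww Nw Ww' Nw').
  by apply/orP; right; apply/exists_inP; exists u; rewrite ?uw.
(* Every [w] in [Mw] has exactly one owner in [R], so the estimates for single owners add up. *)
have gainR : \sum_(s in R) g s + 2 * #|Mw| <= 2 * #|R| + 2 * \sum_(w in Mw) t w.
  have sumR f : \sum_(w in Mw) f w = \sum_(s in R) \sum_(w in N s :&: Mw) f w.
    rewrite sum_nbhd //; apply: eq_bigr => w /ownM[s Rs Nw].
    suff -> : N w :&: R = [set s] by rewrite cards1 mul1n.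
    apply/setP => x; rewrite in_set1; apply/idP/eqP => [/setIP[wx Rx]|->].
      by apply/set1P; rewrite -Nw in_setI wx removed_I.
    by rewrite in_setI Rs andbT; apply: (subsetP (subsetIl _ I)); rewrite Nw set11.
  rewrite -sum1_card !sumR -sum1_card !big_distrr -!big_split /=.
  apply: leq_sum => s Rs; rewrite muln1 sum1_card; apply: gain_owner => //.
  - exact: subsetIr.
  - by move=> w /ownM[s' _ ->]; rewrite cards1.
  - apply/subsetP => w W2w; rewrite in_setI (subsetP sCM) ?in_setU ?W2w ?orbT //=.
    by move: W2w; rewrite inE => /andP[].
by move: cardM coverU0 gainR; clear; lia.
Qed.

End Core.

Lemma extension : exists M : {set V},
  [/\ dominating adj M, independent adj M
    & 16 * #|M| + 4 * e U U + 2 * e U W <= 20 * #|I| + 16 * #|B| + 16 * #|U|].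
Proof.
have [D [sD iD domD cD]] := dominate_nonisolated.
have [|R [sR cfR sumR]] := weighted_independent_set g (d := 6)
  (X := [set s in I | 0 < g s]) conflict_sym conflict_irr.
  move=> s; rewrite inE => /andP[/card_conflict leI _]; apply: leq_trans leI.
  by apply: subset_leq_card; apply/subsetP => s'; rewrite !inE -andbA => /and3P[-> _ ->].
have [M [domM iM cM]] := core_extension sR cfR sD iD domD.
exists M; split=> //.
have sumI : \sum_(s in I) g s = \sum_(s in [set s in I | 0 < g s]) g s.
  rewrite (big_setID [set s in I | 0 < g s]) /= addnC big1 => [|s].
    by rewrite (setIidPr _) //; apply/subsetP => s; rewrite inE => /andP[].
  by rewrite !inE => /andP[+ Is]; rewrite Is lt0n negbK => /eqP.
have cU : #|U| = #|U0| + #|U1| by rewrite -(cardsID U0 U) (setIidPr isolated_sub).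
have eUW : e U W = e U0 W + e U1 W.
  by rewrite {1}/edges (big_setID U0) /= (setIidPr isolated_sub).
(* The bounds on [M] and [D] enter with weight 8, the budget of [U1] with weight 4 and the total
   gain with weight 1; the greedy factor 7 is relaxed to 8. *)
move: gain_total budget_nonisolated sumR cM cD; rewrite sumI cU eUW.
clear; lia.
Qed.

End Extension.

(** * Choosing which endpoint of each edge of [G[S]] to drop *)

Section Orientation.
Set Implicit Arguments.
Unset Strict Implicit.

Variables (V : finType) (adj : rel V).
Hypotheses (adjC : symmetric adj) (adjN : irreflexive adj).
Hypothesis noC4 : ~ has_C4 adj.
Hypothesis cub : cubic adj.
Local Notation N := (nbhd adj).
Local Notation e := (edges adj).

Variable S : {set V}.
Hypothesis domS : dominating adj S.
Let K := [set v in S | N v :&: S != set0].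
Hypothesis matched : {in K, forall v, [/\ #|N v :&: S| = 1,
  forall x, x \notin S -> adj v x -> N x :&: S = [set v]
  & {in N v :\: S &, forall x y, ~~ adj x y}]}.

(** Since [K] induces a perfect matching, the two independence conditions say that [T] picks exactly
    one end of each edge. *)
Let transversal (T : {set V}) :=
  [&& T \subset K, independent adj T & independent adj (K :\: T)].
Let P v := N v :\: S.
Let U (T : {set V}) := \bigcup_(v in T) P v.

Lemma matched_sub : K \subset S. Proof. by apply/subsetP => x; rewrite inE => /andP[]. Qed.

Lemma exists_mate v : v \in K -> exists2 v', N v :&: S = [set v'] &
  [/\ v' \in K, adj v v' & N v' :&: S = [set v]].
Proof.
move=> Kv; have [/eqP/cards1P[v' Nv] _ _] := matched Kv; exists v' => //.
have /setIP[vv' Sv'] : v' \in N v :&: S by rewrite Nv set11.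
have Nv'v : v \in N v' :&: S by rewrite in_setI (in_nbhdC adjC) vv' (subsetP matched_sub).
have Kv' : v' \in K by rewrite inE Sv'; apply/set0Pn; exists v.
rewrite in_nbhd in vv'; split=> //.
have [/eqP/cards1P[v'' Nv'] _ _] := matched Kv'.
by move: Nv'v; rewrite Nv' in_set1 => /eqP->.
Qed.

Lemma in_U (T : {set V}) x :
  T \subset K -> (x \in U T) = (x \notin S) && (N x :&: T != set0).
Proof.
move=> sTK; apply/bigcupP/andP => [[v Tv /setDP[vx Sx]]|[Sx /set0Pn[v /setIP[xv Tv]]]].
  by split=> //; apply/set0Pn; exists v; rewrite in_setI Tv (in_nbhdC adjC) vx.
by exists v; rewrite // in_setD Sx (in_nbhdC adjC).
Qed.

Lemma U_nbhd (T : {set V}) x : T \subset K -> x \in U T ->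
  exists2 v, v \in T & x \notin S /\ N x :&: S = [set v].
Proof.
move=> sTK /bigcupP[v Tv /setDP[vx Sx]]; exists v => //; split=> //.
have [_ pv _] := matched (subsetP sTK v Tv).
by apply: pv => //; rewrite -in_nbhd.
Qed.

Lemma card_P v : v \in K -> #|P v| = 2.
Proof.
move=> Kv; have [c1 _ _] := matched Kv.
by have := cardsID S (N v); rewrite c1 (cub v : #|N v| = 3) => -[].
Qed.

Lemma card_nbhd_transversal (T : {set V}) x : T \subset K -> x \notin S ->
  #|N x :&: T| = (x \in U T).
Proof.
move=> sTK Sx; case: (boolP (x \in U T)) => [/(U_nbhd sTK)[v Tv [_ Nx]]|].
  apply/eqP/cards1P; exists v; apply/setP => y; rewrite in_set1.
  apply/idP/eqP => [/setIP[xy Ty]|->].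
    by apply/set1P; rewrite -Nx in_setI xy (subsetP matched_sub) ?(subsetP sTK).
  by rewrite in_setI Tv andbT; apply: (subsetP (subsetIl _ S)); rewrite Nx set11.
by rewrite in_U // Sx negbK => /eqP->; rewrite cards0.
Qed.

Lemma sum_U (T : {set V}) (f : V -> nat) : T \subset K ->
  \sum_(x in U T) f x = \sum_(v in T) \sum_(x in P v) f x.
Proof.
move=> sTK; rewrite /P; under [RHS]eq_bigr do rewrite setDE.
rewrite sum_nbhd // [RHS](eq_bigr (fun x => if x \in U T then f x else 0)) => [|x].
  rewrite -big_mkcondr; apply: eq_bigl => x.
  by rewrite in_U // in_setC andbA andbb.
by rewrite in_setC => Sx; rewrite card_nbhd_transversal //; case: ifP; rewrite ?mul1n.
Qed.

Lemma card_U (T : {set V}) : T \subset K -> #|U T| = 2 * #|T|.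
Proof.
move=> sTK; rewrite -sum1_card sum_U // mulnC -sum_nat_const.
by apply: eq_bigr => v Tv; rewrite sum1_card card_P // (subsetP sTK).
Qed.

Lemma transversalC T : transversal T -> transversal (K :\: T).
Proof.
case/and3P=> sTK iT iT'; rewrite /transversal subsetDl iT' setDDr setDv set0U.
by rewrite (setIidPr sTK).
Qed.

Lemma transversalK T : transversal T -> K :\: (K :\: T) = T.
Proof. by case/andP=> sTK _; rewrite setDDr setDv set0U (setIidPr sTK). Qed.

Lemma transversal_nbhd T v : transversal T -> v \in T ->
  exists2 v', v' \in K :\: T & [/\ N v :&: (K :\: T) = [set v'],
     N v :&: S = [set v'] & N v' :&: S = [set v]].
Proof.
case/and3P=> sTK iT iT' Tv; have [v' Nv [Kv' vv' Nv']] := exists_mate (subsetP sTK v Tv).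
have Bv' : v' \in K :\: T.
  by rewrite in_setD Kv' andbT; apply: contraL vv'; exact: (indepP _ _ iT).
exists v' => //; split=> //; apply/setP => y; rewrite in_set1.
apply/idP/eqP => [/setIP[vy /setDP[Ky _]]|->].
  by apply/set1P; rewrite -Nv in_setI vy (subsetP matched_sub).
by rewrite in_setI Bv' in_nbhd vv'.
Qed.

Lemma sum_transversal T (f : V -> nat) : transversal T ->
  \sum_(v in K :\: T) f v = \sum_(v in T) \sum_(v' in N v :&: (K :\: T)) f v'.
Proof.
move=> trT; rewrite sum_nbhd //; apply: eq_bigr => v Bv.
have [v' _ []] := transversal_nbhd (transversalC trT) Bv.
by rewrite transversalK // => -> _ _; rewrite cards1 mul1n.
Qed.

Lemma card_transversal T : transversal T -> #|K :\: T| = #|T|.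
Proof.
move=> trT; rewrite -!sum1_card sum_transversal //; apply: eq_bigr => v Tv.
by have [v' _ [-> _ _]] := transversal_nbhd trT Tv; rewrite big_set1.
Qed.

(** A maximal independent subset of [K] contains the mate of every vertex of [K] that it misses, so
    two missed vertices cannot be adjacent. *)
Lemma exists_transversal : exists T, transversal T.
Proof.
have i0 : independent adj set0 by apply/indepP => x y; rewrite inE.
have [T [_ sTK iT maxT]] := maximal_independent adjC adjN i0 (sub0set K).
exists T; apply/and3P; split=> //; apply/indepP => v w /setDP[Kv NTv] /setDP[Kw NTw].
apply/negP => vw; have [y Ty vy] := maxT v Kv NTv.
have [v' Nv _] := exists_mate Kv.
have : y \in N v :&: S by rewrite in_setI in_nbhd vy (subsetP matched_sub) ?(subsetP sTK).
have : w \in N v :&: S by rewrite in_setI in_nbhd vw (subsetP matched_sub).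
rewrite Nv !in_set1 => /eqP wv' /eqP yv'.
by rewrite wv' -yv' Ty in NTw.
Qed.

Lemma swap_transversal T v v' : transversal T -> v \in T -> v' \in K :\: T ->
    N v :&: S = [set v'] -> N v' :&: S = [set v] ->
  transversal (v' |: T :\ v).
Proof.
move=> /and3P[sTK iT iT'] Tv /setDP[Kv' NTv'] Nv Nv'.
have sK x : x \in K -> x \in S by exact: (subsetP matched_sub).
apply/and3P; split.
- by rewrite subUset sub1set Kv' (subset_trans _ sTK) ?subsetDl.
- apply: independentU => //.
  + by apply/indepP => x y; rewrite !in_set1 => /eqP-> /eqP->; rewrite adjN.
  + by apply: independentS iT; rewrite subsetDl.
  + move=> x y; rewrite !inE => /eqP-> /andP[yv Ty]; apply: contraNN yv => v'y.
    by rewrite -in_set1 -Nv' in_setI in_nbhd v'y sK ?(subsetP sTK).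
- have Nvy y : y \in K -> y != v' -> ~~ adj v y.
    move=> Ky; apply: contraNN => vy.
    by rewrite -in_set1 -Nv in_setI in_nbhd vy sK.
  apply/indepP => x y; rewrite !in_setD !in_setU !in_setD !in_set1 !negb_or !negb_and !negbK.
  case/andP=> /andP[xv' xT] Kx /andP[/andP[yv' yT] Ky].
  case/orP: xT => [/eqP->|xT]; first exact: Nvy.
  case/orP: yT => [/eqP->|yT]; first by rewrite adjC Nvy.
  by apply: (indepP _ _ iT'); rewrite in_setD ?xT ?yT.
Qed.

Lemma disjoint_PU v (T : {set V}) : v \in K -> T \subset K -> v \notin T ->
  [disjoint P v & U T].
Proof.
move=> Kv sTK; apply: contraNT; rewrite disjoint_subset => /subsetPn[x /setDP[vx Sx]].
rewrite inE negbK => /(U_nbhd sTK)[w Tw [_ Nx]].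
suff /set1P -> : v \in [set w] by [].
by rewrite -Nx in_setI (in_nbhdC adjC) vx (subsetP matched_sub).
Qed.

Lemma edges_PP v : v \in K -> e (P v) (P v) = 0.
Proof. by move=> Kv; apply: edges_eq0; have [_ _] := matched Kv. Qed.

(** Flipping one edge replaces [P v] by [P v'] in [U T], and neither set has inner edges, so only
    the edges to the common remainder [U (T :\ v)] are compared. *)
Lemma max_transversal_flip T v v' :
    transversal T -> (forall T', transversal T' -> e (U T') (U T') <= e (U T) (U T)) ->
    v \in T -> v' \in K :\: T -> N v :&: S = [set v'] -> N v' :&: S = [set v] ->
  e (P v') (U T) <= e (P v) (U T).
Proof.
move=> trT maxT Tv Bv' Nv Nv'; have := maxT _ (swap_transversal trT Tv Bv' Nv Nv').
have /andP[sTK _] := trT; have /setDP[Kv' NTv'] := Bv'.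
have Kv : v \in K := subsetP sTK v Tv.
have sT0K : T :\ v \subset K by rewrite (subset_trans _ sTK) ?subsetDl.
have NT0v' : v' \notin T :\ v by rewrite in_setD (negPf NTv') andbF.
have -> : U (v' |: T :\ v) = P v' :|: U (T :\ v) by rewrite /U big_setU1.
have -> : U T = P v :|: U (T :\ v) by rewrite /U (big_setD1 v).
have dv := disjoint_PU Kv sT0K (negbT (setD11 _ _)).
have dv' := disjoint_PU Kv' sT0K NT0v'.
rewrite !edges_sqU // !edges_PP // !add0n leq_add2r leq_pmul2l // => le_e.
(* An edge between [P v] and [P v'] would close a 4-cycle with the edge from [v] to [v']. *)
rewrite !edgesUr // edges_PP // edges_eq0 // => x y /setDP[v'x Sx] /setDP[vy Sy].
rewrite !in_nbhd in v'x vy; have Sv' := subsetP matched_sub v' Kv'.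
have vv' : adj v v'.
  by have : v' \in N v :&: S by [rewrite Nv set11]; rewrite in_setI in_nbhd => /andP[].
apply: contraNN Sy => xy.
rewrite (common_nbhd adjC adjN noC4 (a := v) (b := y) (c := x) (d := v')) //.
  by apply: contraNneq Sx => <-; exact: (subsetP matched_sub).
by rewrite adjC.
Qed.

Lemma max_transversal T :
    transversal T -> (forall T', transversal T' -> e (U T') (U T') <= e (U T) (U T)) ->
  e (U (K :\: T)) (U T) <= e (U T) (U T).
Proof.
move=> trT maxT; have /andP[sTK _] := trT.
rewrite /edges !sum_U ?subsetDl // sum_transversal //.
apply: leq_sum => v Tv; have [v' Bv' [-> Nv Nv']] := transversal_nbhd trT Tv.
by rewrite big_set1; exact: max_transversal_flip.
Qed.

Lemma transversal_extension T :
    transversal T -> (forall T', transversal T' -> e (U T') (U T') <= e (U T) (U T)) ->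
  exists M : {set V}, [/\ dominating adj M, independent adj M & 4 * #|M| <= 5 * #|S|].
Proof.
move=> trT maxT; have trB := transversalC trT; have le_e := max_transversal trT maxT.
have cB := card_transversal trT.
have /and3P[sTK iT iB] := trT; have sBK : K :\: T \subset K := subsetDl _ _.
have domT v : v \in T -> exists2 v', v' \in K :\: T & adj v v'.
  move=> Tv; have [v' Bv' [Nv _ _]] := transversal_nbhd trT Tv; exists v' => //.
  by rewrite -in_nbhd; apply: (subsetP (subsetIl _ (K :\: T))); rewrite Nv set11.
have KTB v : v \in K -> v \notin T -> v \in K :\: T by rewrite in_setD => -> ->.
have TNB v : v \in T -> v \notin K :\: T by rewrite in_setD => ->.
move: (K :\: T) cB trB sBK le_e domT KTB TNB iB => B cB trB sBK le_e domT KTB TNB iB.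
pose I := S :\: K; pose W := ~: S :\: U T :\: U B.
have UT := U_nbhd sTK; have UB := U_nbhd sBK.
have Sx_UT x : x \in U T -> x \notin S by case/UT => v _ [].
have Sx_UB x : x \in U B -> x \notin S by case/UB => v _ [].
have sBS := subset_trans sBK matched_sub.
have UTB x : x \in U T -> x \notin U B.
  case/UT=> v Tv [_ Nx]; apply/negP => /UB[w Bw [_]]; rewrite Nx => /set1_inj vw.
  by case/negP: (TNB v Tv); rewrite vw.
have card_split (A : {set V}) :
    #|A| = #|A :&: S| + #|A :&: U T| + #|A :&: U B| + #|A :&: W|.
  have e1 : (A :\: S) :&: U T = A :&: U T.
    apply/setP => x; rewrite !in_setI in_setD.
    by have [/Sx_UT->|] := boolP (x \in U T); rewrite ?andbT ?andbF.
  have e2 : (A :\: S :\: U T) :&: U B = A :&: U B.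
    apply/setP => x; rewrite !in_setI !in_setD.
    have [UBx|] := boolP (x \in U B); rewrite ?andbF //= Sx_UB //.
    by rewrite (contraTN (@UTB x) UBx).
  have e3 : A :\: S :\: U T :\: U B = A :&: W.
    by rewrite /W !setDE !setIA.
  rewrite -(cardsID S A) -(cardsID (U T) (A :\: S)).
  by rewrite -(cardsID (U B) (A :\: S :\: U T)) e1 e2 e3 !addnA.
(* One of the three neighbours of [u] is its unique neighbour in [S]; the other two are distributed
   here. *)
have Nu_card u : u \in U T -> #|N u :&: U T| + #|N u :&: U B| + #|N u :&: W| = 2.
  case/UT=> v _ [_ Nu]; have := card_split (N u).
  by rewrite Nu cards1 (cub u : #|N u| = 3); clear; lia.
have adjS x y v : N x :&: S = [set v] -> y \in S -> adj x y -> y = v.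
  by move=> Nx Sy xy; apply/set1P; rewrite -Nx in_setI in_nbhd xy.
have dI (A : {set V}) : {in A, forall x, x \notin S} -> [disjoint I & A].
  move=> SA; rewrite disjoint_subset; apply/subsetP => x /setDP[Sx _].
  by rewrite inE; apply: contraL Sx; exact: SA.
have SW x : x \in W -> [/\ x \notin S, x \notin U T & x \notin U B].
  by rewrite !in_setD in_setC => /and3P[].
have [||||||||||||M [domM iM cM]] := @extension V adj adjC adjN noC4 cub I B (U T) W.
- exact: dI.
- by apply: dI => x /SW[].
- rewrite disjoint_subset; apply/subsetP => x /(subsetP sBS); rewrite inE.
  exact: contraL (@Sx_UT x).
- rewrite disjoint_subset; apply/subsetP => x Ux; rewrite inE; apply/negP => /SW[_].
  by rewrite Ux.
- rewrite disjoint_subset; apply/subsetP => x /setDP[_ Kx]; rewrite inE.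
  by apply: contraNN Kx; exact: (subsetP sBK).
- have NI x y : x \in I -> y \in S -> ~~ adj x y.
    move=> /setDP[Sx]; rewrite inE Sx negbK => /eqP Nx Sy.
    by apply: contraFN (in_set0 y); rewrite -Nx in_setI in_nbhd Sy => ->.
  apply: independentU => //.
    by apply/indepP => x y Ix /setDP[Sy _]; exact: NI.
  by move=> x y Ix By; apply: NI => //; exact: (subsetP sBS).
(* What remains is [T], dominated by the mates in [B], and [U B]. *)
- move=> x; rewrite !in_setU !in_setD in_setC !negb_or !negb_and !negbK.
  case/andP=> /andP[/andP[xI xB] xU] xW; have [Sx|NSx] := boolP (x \in S).
    rewrite Sx orbF in xI; apply: domT.
    by apply: contraNT xB; exact: KTB.
  move: xW; rewrite (negPf NSx) (negPf xU) /= !orbF in_U //.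
  by rewrite NSx => /set0Pn[b /setIP[]]; rewrite in_nbhd; exists b.
- move=> x y /UT[v Tv [_ Nx]] IBy; apply/negP => xy.
  case/setUP: IBy => [/setDP[Sy]|By].
    by rewrite (adjS _ _ _ Nx Sy xy) (subsetP sTK).
  by case/negP: (TNB v Tv); rewrite -(adjS _ _ _ Nx (subsetP sBS y By) xy).
- by move=> u /Nu_card; clear; lia.
- move=> s /setDP[Ss NKs]; apply/subsetP => y; rewrite in_nbhd => sy.
  have NU (A : {set V}) : A \subset K -> y \notin U A.
    move=> sAK; apply/negP => /(U_nbhd sAK)[v Av [_ Ny]]; case/negP: NKs.
    by rewrite (adjS y s v Ny Ss) ?(subsetP sAK) // adjC.
  rewrite !in_setD in_setC !NU //=; apply: contraNN NKs => Sy.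
  by rewrite inE Ss; apply/set0Pn; exists y; rewrite in_setI in_nbhd sy.
- move=> w b /SW[Sw _ NUw] Bb; apply: contraNN NUw => wb.
  by rewrite in_U // Sw; apply/set0Pn; exists b; rewrite in_setI in_nbhd wb.
- move=> w /SW[Sw NUTw NUBw]; have [y Sy wy] := domP _ _ domS w Sw.
  apply/set0Pn; exists y; rewrite in_setI in_nbhd wy in_setD Sy andbT /=.
  have NU (A : {set V}) : A \subset K -> w \notin U A -> y \notin A.
    move=> sAK; apply: contraNN => Ay; rewrite in_U // Sw.
    by apply/set0Pn; exists y; rewrite in_setI in_nbhd wy.
  by apply/negP => Ky; case/negP: (NU B sBK NUBw); apply: KTB => //; exact: NU.
exists M; split=> //.
have cS : #|S| = #|I| + 2 * #|T|.
  have cKT : #|K| = #|T| + #|B|.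
    rewrite -(cardsID T K) (setIidPr sTK); congr (_ + #|pred_of_set _|).
    apply/setP => x; rewrite in_setD; apply/andP/idP => [[NTx Kx]|Bx]; first exact: KTB.
    by split; [apply: contraL Bx; exact: TNB|exact: (subsetP sBK)].
  by rewrite -(cardsID K S) (setIidPr matched_sub) cKT cB addnC mul2n addnn.
have eU : e (U T) (U T) + e (U T) (U B) + e (U T) W = 2 * #|U T|.
  rewrite mulnC -sum_nat_const /edges -!big_split /=.
  by apply: eq_bigr => u; exact: Nu_card.
(* With k = [#|T|], the degree sum 4k and [le_e] give 2 e(U,U) + e(U,W) >= 4k. Then 16 [#|M|] is at
   most 20 [#|I|] + 48k - 8k, which is 20 [#|S|]. *)
rewrite edgesC // in le_e; rewrite card_U // in eU cM.
by move: cM cS cB le_e eU; clear; lia.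
Qed.

Lemma dominating_extension :
  exists M : {set V}, [/\ dominating adj M, independent adj M & 4 * #|M| <= 5 * #|S|].
Proof.
have [T0 trT0] := exists_transversal.
case: (arg_maxnP (fun T => e (U T) (U T)) trT0) => T trT maxT.
exact: (transversal_extension trT maxT).
Qed.

End Orientation.

(** * From the size bound to the ratio *)

Import Order.TTheory GRing.Theory Num.Theory.
Local Open Scope ring_scope.

Theorem theorem1p8 (V : finType) (adj : rel V)
    (hsimple : simple_graph adj) (hcubic : cubic adj) (hC4 : ~ has_C4 adj) :
  (independent_domination_number adj)%:R / (domination_number adj)%:R
    <= 5%:R / 4%:R :> rat.
Proof.
have [adjC adjN] := hsimple.
have [S [domS minS minE]] := min_dominating_set adj.
have [|M [domM iM leMS]] := @dominating_extension V adj adjC adjN hC4 hcubic S domS.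
  move=> v; rewrite inE => /andP[Sv nSv].
  exact: (min_dominating_matched adjC adjN hcubic domS minS minE Sv nSv).
have le_i : (independent_domination_number adj <= #|M|)%N.
  rewrite /independent_domination_number.
  elim: (index_enum _) (mem_index_enum M) => //= D r IHr.
  rewrite in_cons big_cons => /predU1P[<-|/IHr le_r].
    by rewrite domM iM geq_minl.
  by case: ifP => _ //; rewrite geq_min le_r orbT.
(* The default value [#|V|] of the minimum must be bounded below by [#|S|] as well. *)
have ge_d : (#|S| <= domination_number adj)%N.
  rewrite /domination_number; elim/big_ind: _ => //; first exact: max_card.
  by move=> m n lem len; rewrite leq_min lem.
(* For domination number 0 the quotient is 0, as the inverse of 0 is 0 in [rat]. *)
have [->|d_gt0] := posnP (domination_number adj).
  by rewrite invr0 mulr0 divr_ge0.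
rewrite ler_pdivrMr ?ltr0n // mulrAC ler_pdivlMr ?ltr0n // -!natrM ler_nat.
by move: le_i ge_d leMS; clear; lia.
Qed.
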